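(* Let $k$ be an algebraically closed field of characteristic zero. For all integers $d\geq 2$ and $e$ with $d\leq e\leq d^2$, there exists a Cremona transformation of $\mathbb{P}^3$ (over $k$) of bidegree $(d,e)$.
   Context: A Cremona transformation of $\mathbb{P}^3$ is a birational map $F:\mathbb{P}^3\dashrightarrow\mathbb{P}^3$. It has bidegree $(d,e)$ if $F$ and its inverse $F^{-1}$ are defined by homogeneous polynomials, without non-trivial common factors, of degrees $d$ and $e$ respectively. *)

(* Defs.v *)
From mathcomp Require Import all_boot all_order all_algebra.
From mathcomp Require Import mpoly.

Set Implicit Arguments.
Unset Strict Implicit.
Unset Printing Implicit Defensive.

Import GRing.Theory.
Local Open Scope ring_scope.

(* A representative [f_0 : ... : f_n] of a rational self-map of P^n over k: forms
   of one common degree, not all zero, common factors allowed. Two representatives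
   define the same rational map when they are related by [rat_eq]. *)
Record ratmap (k : fieldType) (n : nat) := RatMap {
  rat_deg : nat;
  rat_forms : n.+1.-tuple {mpoly k[n.+1]};
  rat_homog : forall i, tnth rat_forms i \is rat_deg.-homog;
  rat_neq0 : exists i, tnth rat_forms i != 0
}.

(* Proportionality over the field of fractions, denominators cleared. *)
Definition proportional (k : fieldType) (n : nat)
    (f g : n.+1.-tuple {mpoly k[n.+1]}) : Prop :=
  forall i j, tnth f i * tnth g j = tnth f j * tnth g i.

Definition rat_eq (k : fieldType) (n : nat) (F G : ratmap k n) : Prop :=
  proportional (rat_forms F) (rat_forms G).

Definition coords (k : fieldType) (n : nat) : n.+1.-tuple {mpoly k[n.+1]} :=
  [tuple 'X_i | i < n.+1].

Lemma coords_homog (k : fieldType) (n : nat) (i : 'I_n.+1) :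
  tnth (coords k n) i \is 1.-homog.
Proof. by rewrite tnth_mktuple dhomogX /= mdeg1. Qed.

Lemma coords_neq0 (k : fieldType) (n : nat) :
  exists i, tnth (coords k n) i != 0.
Proof.
by exists ord0; rewrite tnth_mktuple -msize_poly_eq0 msizeX.
Qed.

Definition rat_id (k : fieldType) (n : nat) : ratmap k n :=
  RatMap (@coords_homog k n) (coords_neq0 k n).

Definition subst_forms (k : fieldType) (n : nat)
    (g f : n.+1.-tuple {mpoly k[n.+1]}) : n.+1.-tuple {mpoly k[n.+1]} :=
  [tuple tnth g i \mPo f | i < n.+1].

(* The composite "G after F" exists as a rational map iff the substituted forms
   do not all vanish, i.e. the image of F is not contained in the zero locus of
   the forms of G. *)
Definition is_comp (k : fieldType) (n : nat) (G F H : ratmap k n) : Prop :=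
  (exists i, tnth (subst_forms (rat_forms G) (rat_forms F)) i != 0) /\
  proportional (subst_forms (rat_forms G) (rat_forms F)) (rat_forms H).

Definition is_inverse (k : fieldType) (n : nat) (F G : ratmap k n) : Prop :=
  is_comp G F (rat_id k n) /\ is_comp F G (rat_id k n).

Definition cremona (k : fieldType) (n : nat) (F : ratmap k n) : Prop :=
  exists G : ratmap k n, is_inverse F G.

Definition no_common_factor (k : fieldType) (n : nat)
    (f : n.+1.-tuple {mpoly k[n.+1]}) : Prop :=
  forall p : {mpoly k[n.+1]},
    (forall i, exists q : {mpoly k[n.+1]}, tnth f i = p * q) ->
    exists c : k, p = c%:MP.

Definition has_degree (k : fieldType) (n : nat) (F : ratmap k n) (d : nat) : Prop :=
  exists F' : ratmap k n,
    [/\ rat_eq F F', rat_deg F' = d & no_common_factor (rat_forms F')].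

Definition has_bidegree (k : fieldType) (n : nat) (F : ratmap k n) (d e : nat) : Prop :=
  has_degree F d /\ exists G : ratmap k n, is_inverse F G /\ has_degree G e.

(* Main.v *)
Require Import Defs.
From mathcomp Require Import all_boot all_order all_algebra.
From mathcomp Require Import mpoly zify ring.

(** The transformations are explicit. In the affine chart w = 1, start from the
   monomial map (x, y, z) |-> (x, Y, z x^(j-d+1)) with Y = y / x^(d-1), and add
   Y^s x^(1-s+s(d-1)) to its last coordinate; the result is
   (x, y / x^(d-1), (z x^j + y^s x^(d-s)) / x^(d-1)), which after clearing the
   denominator has degree d when 0 <= j < d and 0 <= s <= d. To invert it,
   subtract Y^s x^(1-s+s(d-1)) from the last coordinate, then multiply this
   coordinate by x^(d-1-j) and Y by x^(d-1): the inverse is polynomial,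
   (x, y x^(d-1), z x^(d-1-j) - y^s x^(e-s)) with e = s (d-1) + d - j, and its
   degree is e as soon as d <= e. Letting j run through [0, d-1] moves e through
   d consecutive values, the last of which is s (d-1) + d, while increasing s by
   one moves this window by d-1. The windows for s = 0, ..., d therefore overlap
   and cover [d, d^2].

   That the two maps are inverse to each other is an identity between monomials
   ([backward_forward], [forward_backward]), valid over every commutative ring;
   the maps are functorial in the ring, so substitution of forms is evaluation
   in the polynomial ring. That d and e are the true degrees, with no common
   factor to remove, comes from [no_common_factor_varX]: in each map one form is
   a power of a variable, and another form is not divisible by that variable. *)

Set Implicit Arguments.
Unset Strict Implicit.
Unset Printing Implicit Defensive.

Import GRing.Theory.

(** * Common factors with a power of a variable *)

Section CommonFactor.

Local Open Scope ring_scope.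

Variables (k : fieldType) (n : nat).
Implicit Types (p q : {mpoly k[n]}) (i : 'I_n).

Definition drop_var i : n.-tuple {mpoly k[n]} :=
  [tuple if l == i then 0 else 'X_l | l < n].

(** Setting 'X_i to 0 is a ring morphism that computes a polynomial modulo 'X_i:
   this is what makes 'X_i a prime element. *)
Lemma drop_varE i q : exists r, q = (q \mPo drop_var i) + 'X_i * r.
Proof.
elim/mpolyind: q => [|c m q _ _ [r {1}->]].
  by exists 0; rewrite comp_mpoly0 mulr0 addr0.
suff [t {1}->] : exists t, 'X_[k, m] = ('X_[m] \mPo drop_var i) + 'X_i * t.
  exists (c *: t + r); rewrite comp_mpolyD comp_mpolyZ scalerDr mulrDr.
  by rewrite -scalerAr addrACA.
rewrite comp_mpolyX; case: (posnP (m i)) => [mi0|mi_gt0].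
  exists 0; rewrite mulr0 addr0 [LHS]mpolyXE_id; apply: eq_bigr => l _.
  by rewrite tnth_mktuple; case: eqP => [->|//]; rewrite mi0 !expr0.
exists 'X_[m - U_(i)].
rewrite (bigD1 i) //= tnth_mktuple eqxx expr0n eqn0Ngt mi_gt0 mul0r add0r.
by rewrite -mpolyXD addmC submK // lep1mP -lt0n.
Qed.

Lemma mpolyX_prime i p q h : p * q = 'X_i * h ->
  (exists r, p = 'X_i * r) \/ (exists r, q = 'X_i * r).
Proof.
move=> /(congr1 (comp_mpoly (drop_var i))).
rewrite !rmorphM /= [X in _ = X * _]comp_mpolyXU.
rewrite -tnth_nth tnth_mktuple eqxx mul0r => /eqP.
rewrite mulf_eq0 => /orP[] /eqP pq0; [left|right].
  by have [r ->] := drop_varE i p; exists r; rewrite pq0 add0r.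
by have [r ->] := drop_varE i q; exists r; rewrite pq0 add0r.
Qed.

(** A point of the hyperplane 'X_i = 0 where p does not vanish shows that 'X_i
   does not divide p, so the prime factors 'X_i all go to the cofactor. *)
Lemma dvd_varX_const i p q N (v : 'I_n -> k) :
    'X_i ^+ N = p * q -> v i = 0 -> p.@[v] != 0 -> exists c : k, p = c%:MP.
Proof.
move=> pq vi0 pv; elim: N q pq => [|N IH] q pq.
  suff : p \is a GRing.unit by case/andP=> /eqP-> _; exists p@_0.
  by apply/unitrP; exists q; rewrite -pq mulrC -pq expr0.
have [[r pE]|[r qE]] := mpolyX_prime (etrans (esym pq) (exprS _ _)).
  by case/eqP: pv; rewrite pE mevalM mevalXU vi0 mul0r.
apply: (IH r); apply: (@mulfI _ ('X_i)).
  by rewrite -msize_poly_eq0 msizeX.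
by rewrite -exprS pq qE mulrCA.
Qed.

End CommonFactor.

Lemma no_common_factor_varX (k : fieldType) (n : nat)
    (f : n.+1.-tuple {mpoly k[n.+1]}) (a b i : 'I_n.+1) N (v : 'I_n.+1 -> k) :
    (tnth f a = 'X_i ^+ N -> v i = 0 -> (tnth f b).@[v] != 0 ->
     no_common_factor f)%R.
Proof.
move=> fa vi0 fb p pf; have [q fpq] := pf a; have [h fph] := pf b.
apply: (@dvd_varX_const _ _ i p q N v) => //; first by rewrite -fpq fa.
by move: fb; rewrite fph mevalM mulf_eq0 negb_or => /andP[].
Qed.

(** * Monomials in four elements of a commutative ring *)

Section Monomials.

Local Open Scope ring_scope.

Variable R : comNzRingType.
Implicit Types v : 4.-tuple R.

Definition monomial4 v (a b c f : nat) : R :=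
  v`_0 ^+ a * v`_1 ^+ b * v`_2 ^+ c * v`_3 ^+ f.

Lemma monomial4M v a b c f a' b' c' f' :
  monomial4 v a b c f * monomial4 v a' b' c' f' =
  monomial4 v (a + a') (b + b') (c + c') (f + f').
Proof. by rewrite /monomial4 !exprD; ring. Qed.

Lemma monomial4X v a b c f N :
  monomial4 v a b c f ^+ N = monomial4 v (a * N) (b * N) (c * N) (f * N).
Proof. by rewrite /monomial4 !exprMn -!exprM. Qed.

Lemma nth_monomial4 v :
  [/\ v`_0 = monomial4 v 1 0 0 0, v`_1 = monomial4 v 0 1 0 0,
      v`_2 = monomial4 v 0 0 1 0 & v`_3 = monomial4 v 0 0 0 1].
Proof. by rewrite /monomial4 !expr0 !expr1 !mulr1 !mul1r. Qed.

End Monomials.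

Section MonomialMorphism.

Local Open Scope ring_scope.

Lemma monomial4_map (R S : comNzRingType) (phi : {rmorphism R -> S})
    (v : 4.-tuple R) a b c f :
  monomial4 (map_tuple phi v) a b c f = phi (monomial4 v a b c f).
Proof.
case: v => [[|w [|x [|y [|z [|? ?]]]]]] // v4.
by rewrite /monomial4 /= !rmorphM !rmorphXn.
Qed.

Variable k : fieldType.

Lemma nth_coords (i : 'I_4) : (coords k 3)`_i = 'X_i.
Proof. by rewrite -tnth_nth tnth_mktuple. Qed.

Lemma monomial4_coords a b c f :
  monomial4 (coords k 3) a b c f =
  'X_(0%R) ^+ a * 'X_(1%R) ^+ b * 'X_(2%R) ^+ c * 'X_(3%R) ^+ f.
Proof.
by rewrite /monomial4 -(nth_coords 0) -(nth_coords 1) -(nth_coords 2)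
  -(nth_coords 3).
Qed.

Lemma monomial4_homog a b c f N : (a + b + c + f)%N = N ->
  monomial4 (coords k 3) a b c f \is N.-homog.
Proof.
move=> <-; have XE i M : ('X_i ^+ M : {mpoly k[4]}) \is M.-homog.
  by rewrite -[M in M.-homog]mul1n dhomogMn // dhomogX /= mdeg1.
by rewrite monomial4_coords !dhomogM.
Qed.

Lemma monomial4_neq0 a b c f : monomial4 (coords k 3) a b c f != 0.
Proof.
have X0 i N : 'X_i ^+ N != 0 :> {mpoly k[4]}.
  by rewrite expf_neq0 // -msize_poly_eq0 msizeX.
by rewrite monomial4_coords !mulf_neq0.
Qed.

End MonomialMorphism.

(** * The family of transformations and its inverses *)

Lemma is_comp_id (k : fieldType) (n : nat) (G F : ratmap k n)
    (lam : {mpoly k[n.+1]}) : (lam != 0)%R ->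
  (forall i, tnth (subst_forms (rat_forms G) (rat_forms F)) i =
             lam * tnth (coords k n) i)%R ->
  is_comp G F (rat_id k n).
Proof.
move=> lam0 compE; split; last first.
  by move=> i l; rewrite !compE /=; ring.
have [i Xi0] := coords_neq0 k n.
by exists i; rewrite compE mulf_neq0.
Qed.

Section Family.

Local Open Scope ring_scope.

Variables d j s e : nat.

(** The forms are functions of four ring elements, so that one polynomial
   identity serves for composition, and functoriality for substitution. *)
Definition forward (R : comNzRingType) (v : 4.-tuple R) : 4.-tuple R :=
  [tuple monomial4 v 1 d.-1 0 0; monomial4 v 0 d 0 0; monomial4 v d.-1 0 1 0;
         monomial4 v (d.-1 - j) j 0 1 + monomial4 v 0 (d - s) s 0].

Definition backward (R : comNzRingType) (v : 4.-tuple R) : 4.-tuple R :=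
  [tuple monomial4 v e 0 0 0; monomial4 v e.-1 1 0 0;
         monomial4 v (e - d) d.-1 1 0;
         monomial4 v (s * d.-1) (d.-1 - j) 0 1 - monomial4 v 0 (e - s) s 0].

Lemma forward_map (R S : comNzRingType) (phi : {rmorphism R -> S})
    (v : 4.-tuple R) i :
  tnth (forward (map_tuple phi v)) i = phi (tnth (forward v) i).
Proof.
by case: i => [[|[|[|[|//]]]] ?];
  rewrite !(tnth_nth 0) /= !monomial4_map // rmorphD.
Qed.

Lemma backward_map (R S : comNzRingType) (phi : {rmorphism R -> S})
    (v : 4.-tuple R) i :
  tnth (backward (map_tuple phi v)) i = phi (tnth (backward v) i).
Proof.
by case: i => [[|[|[|[|//]]]] ?];
  rewrite !(tnth_nth 0) /= !monomial4_map // rmorphB.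
Qed.

Hypotheses (d_gt1 : (1 < d)%N) (j_lt : (j < d)%N) (s_le : (s <= d)%N).
Hypotheses (d_le : (d <= e)%N) (eE : (e + j = s * d.-1 + d)%N).

(** Names for the differences that occur as exponents. The last four equations
   are the products of these relations that make the exponent comparisons
   below linear. *)
Lemma exponent_relations : exists D r u q l,
  [/\ [/\ d.-1 = D, d.-1 - j = r, d - s = u, e - d = q & e - s = l]%N,
      [/\ D = j + r, d = D.+1, e = q + D.+1, s * D = q + j & l = q + u]%N,
      (s + u = D.+1)%N &
      [/\ D * u + s * D = D * D + D, D * D = D * j + D * r,
          q * D = q * j + q * r & q * u + q * s = q * D + q]%N].
Proof.
exists d.-1, (d.-1 - j)%N, (d - s)%N, (e - d)%N, (e - s)%N.
have s_leM : (s <= s * d.-1)%N by rewrite leq_pmulr //; lia.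
have D_split : d.-1 = (j + (d.-1 - j))%N by lia.
have d_split : (d - s + s = d.-1.+1)%N by lia.
split=> //; [by split; lia | by lia | split].
- by rewrite [X in (_ + X)%N]mulnC -mulnDr d_split mulnS addnC.
- by rewrite -mulnDr -D_split.
- by rewrite -mulnDr -D_split.
- by rewrite -mulnDr d_split mulnS addnC.
Qed.

Lemma backward_forward (R : comNzRingType) (v : 4.-tuple R) i :
  tnth (backward (forward v)) i =
  monomial4 v e.-1 (d.-1 * e) 0 0 * tnth v i.
Proof.
have [D [r [u [q [l [[dp rE uE qE lE] [DE dE eqD sD luE] su]]]]]]
  := exponent_relations; move=> [Du DD qD qs].
have e1 : e.-1 = (q + D)%N by lia.
have [v0 v1 v2 v3] := nth_monomial4 v.
have [f0 f1 f2 f3] : let f := forward v in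
  [/\ f`_0 = monomial4 v 1 D 0 0, f`_1 = monomial4 v 0 D.+1 0 0,
      f`_2 = monomial4 v D 0 1 0 &
      f`_3 = monomial4 v r j 0 1 + monomial4 v 0 u s 0].
  by rewrite -dE -dp -rE -uE.
move: (forward v) f0 f1 f2 f3 => f f0 f1 f2 f3.
rewrite /backward qE lE rE e1 dp sD eqD.
case: i => [[|[|[|[|//]]]] ?]; rewrite !(tnth_nth 0) /=.
all: rewrite ![monomial4 f _ _ _ _]/monomial4 f0 f1 f2 f3 ?v0 ?v1 ?v2 ?v3.
all: rewrite !expr0 ?expr1 ?mulr1 ?mul1r ?mulrDr !monomial4X ?monomial4M.
- congr monomial4; lia.
- congr monomial4; lia.
- congr monomial4; lia.
(* The two monomials in y^s cancel. *)
rewrite -addrA -[RHS]addr0; congr (_ + _); first by congr monomial4; lia.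
by apply/eqP; rewrite subr_eq0; apply/eqP; congr monomial4; rewrite ?luE; lia.
Qed.

Lemma forward_backward (R : comNzRingType) (v : 4.-tuple R) i :
  tnth (forward (backward v)) i =
  monomial4 v (e.-1 * d) d.-1 0 0 * tnth v i.
Proof.
have [D [r [u [q [l [[dp rE uE qE lE] [DE dE eqD sD luE] su]]]]]]
  := exponent_relations; move=> [Du DD qD qs].
have e1 : e.-1 = (q + D)%N by lia.
have [v0 v1 v2 v3] := nth_monomial4 v.
have [f0 f1 f2 f3] : let f := backward v in
  [/\ f`_0 = monomial4 v e 0 0 0, f`_1 = monomial4 v (q + D) 1 0 0,
      f`_2 = monomial4 v q D 1 0 &
      f`_3 = monomial4 v (q + j) r 0 1 - monomial4 v 0 l s 0].
  by rewrite -e1 -sD -dp -rE -lE -qE.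
move: (backward v) f0 f1 f2 f3 => f f0 f1 f2 f3.
rewrite /forward uE rE e1 dp dE.
case: i => [[|[|[|[|//]]]] ?]; rewrite !(tnth_nth 0) /=.
all: rewrite ![monomial4 f _ _ _ _]/monomial4 f0 f1 f2 f3 ?v0 ?v1 ?v2 ?v3 eqD.
all: rewrite !expr0 ?expr1 ?mulr1 ?mul1r ?mulrDr !monomial4X ?monomial4M.
- congr monomial4; lia.
- congr monomial4; lia.
- congr monomial4; lia.
rewrite mulrN monomial4M -addrA -[RHS]addr0.
congr (_ + _); first by congr monomial4; lia.
apply/eqP; rewrite addrC subr_eq0; apply/eqP.
by congr monomial4; rewrite ?luE; lia.
Qed.

Variable k : fieldType.
Local Notation X := (coords k 3).

Lemma forward_homog i : tnth (forward X) i \is d.-homog.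
Proof.
case: i => [[|[|[|[|//]]]] ?]; rewrite (tnth_nth 0) /=; last apply: rpredD.
all: by apply: monomial4_homog; lia.
Qed.

Lemma backward_homog i : tnth (backward X) i \is e.-homog.
Proof.
have s_leM : (s <= s * d.-1)%N by rewrite leq_pmulr //; lia.
case: i => [[|[|[|[|//]]]] ?]; rewrite (tnth_nth 0) /=; last apply: rpredB.
all: by apply: monomial4_homog; lia.
Qed.

Lemma forward_neq0 : exists i, tnth (forward X) i != 0.
Proof. by exists 0; rewrite (tnth_nth 0) monomial4_neq0. Qed.

Lemma backward_neq0 : exists i, tnth (backward X) i != 0.
Proof. by exists 0; rewrite (tnth_nth 0) monomial4_neq0. Qed.

Definition forward_ratmap : ratmap k 3 := RatMap forward_homog forward_neq0.
Definition backward_ratmap : ratmap k 3 := RatMap backward_homog backward_neq0.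

Lemma map_comp_coords (f : 4.-tuple {mpoly k[4]}) :
  map_tuple (comp_mpoly f) X = f.
Proof.
by apply: eq_from_tnth => i; rewrite tnth_map tnth_mktuple comp_mpolyXU -tnth_nth.
Qed.

Lemma forward_inverse : is_inverse forward_ratmap backward_ratmap.
Proof.
split.
- apply: is_comp_id (monomial4_neq0 k e.-1 (d.-1 * e) 0 0) _ => i /=.
  rewrite tnth_mktuple -(backward_map (comp_mpoly (forward X))).
  by rewrite map_comp_coords backward_forward.
- apply: is_comp_id (monomial4_neq0 k (e.-1 * d) d.-1 0 0) _ => i /=.
  rewrite tnth_mktuple -(forward_map (comp_mpoly (backward X))).
  by rewrite map_comp_coords forward_backward.
Qed.

Lemma map_meval_coords (v : 4.-tuple k) :
  map_tuple (meval (tnth v)) X = v.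
Proof.
by apply: eq_from_tnth => i; rewrite tnth_map tnth_mktuple mevalXU.
Qed.

Lemma forward_no_common_factor : no_common_factor (forward X).
Proof.
(* x^d against y w^(d-1), which is 1 at this point of the plane x = 0 *)
apply: (@no_common_factor_varX _ _ _ 1 2 1 d (tnth [tuple 1; 0; 1; 0])) => //.
  by rewrite (tnth_nth 0) [LHS]monomial4_coords !expr0 !mulr1 mul1r.
rewrite -(forward_map (meval (tnth [tuple 1; 0; 1; 0]))) map_meval_coords.
by rewrite (tnth_nth 0) /= /monomial4 /= !expr1n !mulr1 oner_eq0.
Qed.

Lemma backward_no_common_factor : no_common_factor (backward X).
Proof.
(* w^e against the last form, which is - y^s x^(e-s) at z = 0 *)
apply: (@no_common_factor_varX _ _ _ 0 3 0 e (tnth [tuple 0; 1; 1; 0])) => //.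
  by rewrite (tnth_nth 0) [LHS]monomial4_coords !expr0 !mulr1.
rewrite -(backward_map (meval (tnth [tuple 0; 1; 1; 0]))) map_meval_coords.
rewrite (tnth_nth 0) /= /monomial4 /= !expr1n expr1 mulr0 sub0r !mulr1.
by rewrite oppr_eq0 oner_eq0.
Qed.

Lemma forward_bidegree : has_bidegree forward_ratmap d e.
Proof.
split; last exists backward_ratmap; last split; last first.
- exists backward_ratmap; split=> //; last exact: backward_no_common_factor.
  by move=> i l; rewrite mulrC.
- exact: forward_inverse.
exists forward_ratmap; split=> //; last exact: forward_no_common_factor.
by move=> i l; rewrite mulrC.
Qed.

End Family.

(** * Choice of the parameters *)

(** Division of e - 2 by d - 1, with quotient s and remainder d - 2 - j. The
   shift by 2 keeps s <= d even for e = d^2, where dividing e - 1 would give the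
   quotient d + 1. *)
Lemma bidegree_parameters (d e : nat) : 2 <= d -> d <= e -> e <= d ^ 2 ->
  exists j s, [/\ j < d, s <= d & e + j = s * d.-1 + d].
Proof.
move=> d_gt1 d_le e_le.
have D_gt0 : 0 < d.-1 by lia.
have := divn_eq (e - 2) d.-1; have := ltn_pmod (e - 2) D_gt0.
move: (_ %/ _) (_ %% _) => s m m_lt eE.
exists (d - 2 - m), s; split; [lia | | lia].
rewrite leqNgt; apply/negP => s_gt.
have : d.+1 * d.-1 <= s * d.-1 by rewrite leq_mul2r s_gt orbT.
by move: e_le; rewrite expnS expn1; case: d d_gt1 d_le eE {D_gt0 m_lt s_gt}
  => [|[|d]] //=; nia.
Qed.

Theorem theorem3 (k : closedFieldType) (hk : [pchar k]%R =i pred0)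
    (d e : nat) (hd : 2 <= d) (hde : d <= e) (hed : e <= d ^ 2) :
  exists F : ratmap k 3, cremona F /\ has_bidegree F d e.
Proof.
have [j [s [j_lt s_le eE]]] := bidegree_parameters hd hde hed.
exists (forward_ratmap hd j_lt s_le hde eE k); split; last first.
  exact: (forward_bidegree hd j_lt s_le hde eE).
exists (backward_ratmap hd j_lt s_le hde eE k); exact: forward_inverse.
Qed.
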